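(* Let $R$ be an associative ring with identity and let $a,b\in R$. If $ab$ is Drazin invertible, then $ba$ is Drazin invertible and $(ba)^{D}=b\big((ab)^{D}\big)^2a$.
   Context: For $x\in R$, $comm(x)=\{y\in R\mid xy=yx\}$ and $comm^2(x)=\{y\in R\mid yz=zy\text{ for all }z\in comm(x)\}$. $Nil(R)$ is the set of nilpotent elements of $R$. An element $x\in R$ is Drazin invertible if there is $y\in R$ with $xy^2=y$, $y\in comm^2(x)$ and $x^2y-x\in Nil(R)$. Such a $y$ is unique if it exists; it is called the Drazin inverse of $x$ and denoted $x^{D}$. *)

(* Defs.v *)
From HB Require Import structures.
From mathcomp Require Import all_boot all_algebra.
From mathcomp Require Import boolp classical_sets.
Set Implicit Arguments.
Unset Strict Implicit.
Unset Printing Implicit Defensive.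
Import GRing.Theory.
Local Open Scope classical_set_scope.
Local Open Scope ring_scope.

Definition comm_set (R : pzRingType) (x : R) : set R :=
  [set y | x * y = y * x].

Definition comm2_set (R : pzRingType) (x : R) : set R :=
  [set y | forall z, comm_set x z -> y * z = z * y].

Definition Nil (R : pzRingType) : set R := [set x | exists n, x ^+ n = 0].

Definition is_drazin_inverse (R : pzRingType) (x y : R) : Prop :=
  [/\ x * y ^+ 2 = y, comm2_set x y & @Nil R (x ^+ 2 * y - x)].

Definition drazin_invertible (R : pzRingType) (x : R) : Prop :=
  exists y, is_drazin_inverse x y.

(* [x^D], with the junk value 0 when [x] is not Drazin invertible. *)
Definition drazin_inv (R : pzRingType) (x : R) : R :=
  xget 0 [set y | is_drazin_inverse x y].

Lemma drazin_inverse_unique (R : pzRingType) (x y z : R) :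
  is_drazin_inverse x y -> is_drazin_inverse x z -> y = z.
Proof.
have key u v : is_drazin_inverse x u -> is_drazin_inverse x v ->
    x * v = x * u * (x * v).
  move=> [u2 uC [n nil_u]] [v2 vC _].
  have cux : GRing.comm u x by apply: uC.
  have cvx : GRing.comm v x by apply: vC.
  have e2 : x * u * (x * u) = x * u.
    by rewrite -mulrA (mulrA u) cux -mulrA -expr2 u2.
  have f2 : x * v * (x * v) = x * v.
    by rewrite -mulrA (mulrA v) cvx -mulrA -expr2 v2.
  have cxe : GRing.comm x (x * u) by rewrite /GRing.comm -[RHS]mulrA cux.
  have E : x ^+ 2 * u - x = x * (x * u - 1) by rewrite mulrBr mulr1 expr2 mulrA.
  have cx1 : GRing.comm x (x * u - 1) by apply: commrB => //; exact: commr1.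
  have idem k : (x * u - 1) ^+ k * (x * u - 1) = (- 1) ^+ k * (x * u - 1).
    elim: k => [|k IH]; first by rewrite !expr0.
    rewrite exprSr -mulrA.
    have -> : (x * u - 1) * (x * u - 1) = - (x * u - 1).
      by rewrite mulrBr mulr1 mulrBl mul1r e2 subrr sub0r.
    by rewrite mulrN IH exprS mulN1r mulNr.
  have xn : x ^+ n * (x * u - 1) = 0.
    have : x ^+ n * ((x * u - 1) ^+ n * (x * u - 1)) = 0.
      by rewrite mulrA -exprMn_comm // -E nil_u mul0r.
    rewrite idem -signr_odd; case: (odd n) => /=.
      by rewrite expr1 mulN1r mulrN => /eqP; rewrite oppr_eq0 => /eqP.
    by rewrite expr0 mul1r.
  have fn : x ^+ n.+1 * v ^+ n.+1 = x * v.
    rewrite -exprMn_comm; last exact/commr_sym.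
    by elim: n {nil_u xn} => [|k IH]; rewrite ?expr1 // exprS IH f2.
  have xn1 : x * u * x ^+ n.+1 = x ^+ n.+1.
    have ->: x * u * x ^+ n.+1 = x ^+ n.+1 * (x * u).
      by apply: commrX; apply: commr_sym.
    apply/eqP; rewrite -subr_eq0 -[X in _ - X]mulr1 -mulrBr.
    by rewrite exprS -mulrA xn mulr0.
  by rewrite -[in RHS]fn mulrA xn1 fn.
move=> hy hz; have e := key _ _ hy hz; have f := key _ _ hz hy.
have [y2 yC _] := hy; have [z2 zC _] := hz.
have cyx : y * x = x * y by apply: yC.
have czx : z * x = x * z by apply: zC.
have cyz : y * z = z * y by apply: yC; rewrite /comm_set /= czx.
have ef : x * y = x * z.
  rewrite [LHS]f [RHS]e -!mulrA; congr (x * _).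
  by rewrite !mulrA czx cyx -!mulrA cyz.
transitivity (x * y * y); first by rewrite -mulrA -expr2 y2.
by rewrite ef -mulrA -cyz mulrA ef -mulrA -expr2 z2.
Qed.

Lemma drazin_invE (R : pzRingType) (x y : R) :
  is_drazin_inverse x y -> drazin_inv x = y.
Proof.
move=> hy; apply: (drazin_inverse_unique _ hy).
by rewrite /drazin_inv; case: xgetP => [z _ //|/(_ y) []].
Qed.

(* Main.v *)
(* With c = ab and d its Drazin inverse, y = b d^2 a is the Drazin inverse of
   ba. It lies in comm^2(ba) because z in comm(ba) forces azb in comm(c), so d
   commutes with azb. Moreover (ba)^2 y - ba = b (cd - 1) a, whose powers are
   b ((cd - 1) c)^n (cd - 1) a, and (cd - 1) c = c^2 d - c is nilpotent. *)
Require Import Defs.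
From mathcomp Require Import all_boot all_algebra.
Import GRing.Theory.
Local Open Scope ring_scope.

(** Each inner [a * b] is absorbed by the [u] on its left, so nilpotency of [u * (a * b)] passes to
    [b * u * a] with the exponent raised by one. *)
Lemma exprS_sandwich (R : pzRingType) (a b u : R) (n : nat) :
  (b * u * a) ^+ n.+1 = b * (u * (a * b)) ^+ n * u * a.
Proof.
elim: n => [|n IHn]; first by rewrite expr1 expr0 mulr1.
by rewrite exprSr IHn [in RHS]exprSr !mulrA.
Qed.

Lemma comm_set_sandwich (R : pzRingType) (a b z : R) :
  comm_set (b * a) z -> comm_set (a * b) (a * z * b).
Proof.
move=> zC; rewrite /comm_set /=.
transitivity (a * (b * a * z) * b); first by rewrite !mulrA.
by rewrite zC !mulrA.
Qed.

Lemma Cline_formula (R : pzRingType) (a b d : R) :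
  is_drazin_inverse (a * b) d -> is_drazin_inverse (b * a) (b * d ^+ 2 * a).
Proof.
move=> [cdd dC [n nil_n]].
have dc : d * (a * b) = a * b * d by apply: dC.
have ddc : d ^+ 2 * (a * b) = d.
  by rewrite expr2 -mulrA dc mulrA dc -mulrA -expr2.
split.
- transitivity (b * (a * b * d ^+ 2) * (a * b * d ^+ 2) * a).
    by rewrite (expr2 (b * _ * a)) !mulrA.
  by rewrite cdd expr2 !mulrA.
- move=> z zC.
  (* The cube makes room: writing [d ^+ 2] as [d ^+ 3 * (a * b)] turns [b * d ^+ 2 * a * z] into a
     product containing [b * a * z]. Swapping [z] past [b * a] then exposes [a * z * b], which
     commutes with [d ^+ 3]. *)
  have dw : d ^+ 3 * (a * z * b) = a * z * b * d ^+ 3.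
    apply: commr_sym; apply: commrX; apply: commr_sym.
    exact/dC/comm_set_sandwich.
  have d3l : d ^+ 3 * (a * b) = d ^+ 2 by rewrite exprS -mulrA ddc -expr2.
  have d3r : a * b * d ^+ 3 = d ^+ 2 by rewrite exprSr mulrA cdd -expr2.
  transitivity (b * d ^+ 3 * a * (b * a * z)); first by rewrite -d3l !mulrA.
  rewrite zC.
  transitivity (b * (d ^+ 3 * (a * z * b)) * a); first by rewrite !mulrA.
  rewrite dw.
  transitivity (b * a * z * b * d ^+ 3 * a); first by rewrite !mulrA.
  by rewrite zC -d3r !mulrA.
- exists n.+1.
  have -> : (b * a) ^+ 2 * (b * d ^+ 2 * a) - b * a = b * (a * b * d - 1) * a.
    (* Expanding [d] on the right as [a * b * d ^+ 2] makes both sides agree up to associativity. *)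
    rewrite mulrBr mulrBl mulr1 -[in RHS]cdd expr2.
    by rewrite !mulrA.
  rewrite exprS_sandwich.
  have -> : (a * b * d - 1) * (a * b) = (a * b) ^+ 2 * d - a * b.
    by rewrite mulrBl mul1r -mulrA dc mulrA -expr2.
  by rewrite nil_n mulr0 !mul0r.
Qed.

Theorem theorem2p7 (R : pzRingType) (a b : R) :
  drazin_invertible (a * b) ->
  drazin_invertible (b * a) /\
  drazin_inv (b * a) = b * drazin_inv (a * b) ^+ 2 * a.
Proof.
move=> [d hd]; rewrite (drazin_invE hd).
have hy := Cline_formula _ _ _ _ hd.
by split; [exists (b * d ^+ 2 * a) | exact: drazin_invE].
Qed.
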